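(* Let $\mathcal{X}$ be an input set, $\mathcal{Y}$ an output set, and $\mathcal{F}$ a set of models $f:\mathcal{X}\to\mathcal{Y}$. Let $n,m\ge 1$. For $i=1,\dots,n$ let $t_i=(p_i,S_i,\ell_i)$ be a learning task, where $p_i$ is a probability distribution on $\mathcal{X}\times\mathcal{Y}$, $\ell_i:\mathcal{Y}\times\mathcal{Y}\to[0,1]$ is a loss function, and $S_i=\{(x_{i,1},y_{i,1}),\dots,(x_{i,m},y_{i,m})\}$ is a sample of size $m$ drawn i.i.d. from $p_i$, the samples $S_1,\dots,S_n$ being drawn independently of each other. Let $\mathcal{E}$ be a set (of ''global parameters'') and let $l:\mathcal{E}\to\mathbb{N}$ be the length function of a prefix-free encoding of $\mathcal{E}$ (the meta-encoder). For each $E\in\mathcal{E}$, let $l_E:\bigcup_{k=1}^\infty\mathcal{F}^k\to\mathbb{N}$ be the length function of a prefix-free encoding of $\bigcup_{k=1}^\infty\mathcal{F}^k$ (the multi-task encoder given $E$). Then for any $\delta>0$, with probability at least $1-\delta$ over the sampling of $S_1,\dots,S_n$, for all $E\in\mathcal{E}$ and all $f_1,\dots,f_n\in\mathcal{F}$: $$\mathrm{kl}\Big(\widehat{\mathcal{R}}(f_1,\dots,f_n)\,\Big|\,\mathcal{R}(f_1,\dots,f_n)\Big)\le\frac{\big(l(E)+l_E(f_1,\dots,f_n)\big)\log 2+\log\frac{2\sqrt{mn}}{\delta}}{mn}.$$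
   Context: A (prefix-free) encoding of a set $\mathcal{Z}$ is a map $C:\mathcal{Z}\to\{0,1\}^*$ such that for all $z\neq z'$ in $\mathcal{Z}$, $C(z)$ is not a prefix of $C(z')$; its length function is $z\mapsto$ length of $C(z)$. The multi-task risk is $\mathcal{R}(f_1,\dots,f_n)=\frac1n\sum_{i=1}^n \mathbb{E}_{(x,y)\sim p_i}\ell_i(y,f_i(x))$ and the multi-task empirical risk is $\widehat{\mathcal{R}}(f_1,\dots,f_n)=\frac{1}{mn}\sum_{i=1}^n\sum_{j=1}^m \ell_i(y_{i,j},f_i(x_{i,j}))$. For $q,p\in[0,1]$, $\mathrm{kl}(q|p)=q\log\frac{q}{p}+(1-q)\log\frac{1-q}{1-p}$ is the Kullback–Leibler divergence between Bernoulli distributions with means $q$ and $p$ (with the usual conventions $0\log 0=0$). *)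

(* Defs.v *)
From Stdlib Require List.
From HB Require Import structures.
From mathcomp Require Import all_boot all_order all_algebra.
From mathcomp Require Import all_classical all_reals all_analysis.
Set Implicit Arguments. Unset Strict Implicit. Unset Printing Implicit Defensive.
Import Order.TTheory GRing.Theory Num.Theory.
Local Open Scope classical_set_scope.
Local Open Scope ring_scope.

Definition prefix_free_on (Z : Type) (D : set Z) (C : Z -> seq bool) : Prop :=
  forall z z', D z -> D z' -> z <> z' -> ~~ prefix (C z) (C z').

Definition is_prefix_free_length (Z : Type) (D : set Z) (l : Z -> nat) : Prop :=
  exists C : Z -> seq bool, prefix_free_on D C /\ forall z, D z -> l z = size (C z).

Definition tuples_of (A : Type) (F : set A) : set (seq A) :=
  [set s | (0 < size s)%N /\ forall a, List.In a s -> F a].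

Definition klterm (R : realType) (x y : R) : \bar R :=
  if x == 0 then 0%E else if y == 0 then +oo%E else (x * ln (x / y))%:E.

(* KL divergence between Bernoulli(q) and Bernoulli(p), extended-real valued *)
Definition kl (R : realType) (q p : R) : \bar R :=
  (klterm q p + klterm (1 - q) (1 - p))%E.

(* Z i j (i < n, j < m) is an i.i.d. sample: each S_i = (Z i j)_j is i.i.d.
   from p i and the samples are mutually independent; equivalently the family
   (Z i j)_{i,j} is mutually independent with Z i j distributed as p i. *)
Definition iid_samples (R : realType) (dO dX dY : measure_display)
  (Om : measurableType dO) (X : measurableType dX) (Y : measurableType dY)
  (n m : nat) (P : probability Om R) (p : 'I_n -> probability (X * Y)%type R)
  (Z : 'I_n -> 'I_m -> Om -> (X * Y)%type) : Prop :=
  (forall i j, measurable_fun setT (Z i j)) /\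
  forall A : 'I_n -> 'I_m -> set (X * Y)%type,
    (forall i j, measurable (A i j)) ->
    P [set w | forall i j, A i j (Z i j w)] = (\prod_(i < n) \prod_(j < m) p i (A i j))%E.

Definition emp_risk (R : realType) (X Y : Type) (n m : nat)
  (loss : 'I_n -> Y -> Y -> R) (S : 'I_n -> 'I_m -> (X * Y)%type)
  (f : 'I_n -> X -> Y) : R :=
  (m * n)%:R^-1 * \sum_(i < n) \sum_(j < m) loss i (S i j).2 (f i (S i j).1).

Definition mt_risk (R : realType) (dX dY : measure_display)
  (X : measurableType dX) (Y : measurableType dY) (n : nat)
  (p : 'I_n -> probability (X * Y)%type R)
  (loss : 'I_n -> Y -> Y -> R) (f : 'I_n -> X -> Y) : R :=
  n%:R^-1 * \sum_(i < n) fine (\int[p i]_z (loss i z.2 (f i z.1))%:E)%E.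

(* Main.v *)
Require Import Defs.
From HB Require Import structures.
From mathcomp Require Import all_boot all_order all_algebra.
From mathcomp Require Import all_classical all_reals all_analysis.
From mathcomp Require Import measurable_realfun ring lra.
Import Order.TTheory GRing.Theory Num.Theory.
Import numFieldNormedType.Exports.
Local Open Scope classical_set_scope.
Local Open Scope ring_scope.

(** Write N = mn and kl for the divergence between the two risks. Appending the
    code of the tuple given E to the code of E is again a prefix-free code, so
    by Kraft's inequality it is enough to bound by delta 2^-L the probability
    that the inequality fails for one (E, f) of code length L; by Markov's
    inequality this follows from E[exp (N kl)] <= 2 sqrt N (Maurer).

    If x_1, ..., x_N are the losses, with mean t, and r is the risk, convexity of
    exp gives exp (N kl) <= prod_k (x_k t/r + (1 - x_k) (1 - t)/(1 - r)).
    Expanding the product over subsets, t^k (1 - t)^(N-k) is at most 2 sqrt N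
    times the Krichevsky-Trofimov weight w(k, N - k), which does not depend on the
    sample. Independence then replaces each x_k by its expectation, and
    since w(k, N - k) / (r^k (1 - r)^(N-k)) is convex in k, Hoeffding's smoothing
    replaces all these expectations by their mean r. What remains is
    sum_k C(N, k) w(k, N - k) = 1. *)

(** * Two midpoint inequalities for the logarithm *)

(** The right side is the integral of the convex function 1/u over [x - s, x + s], the left side its
    midpoint estimate. *)
Lemma ln_ratio_ge (R : realType) (x s : R) : 0 <= s -> s < x ->
  2 * s / x <= ln (x + s) - ln (x - s).
Proof.
move=> s0 sx; have x0 : 0 < x by lra.
pose f t : R := ln (x + t) - ln (x - t) - 2 * t / x.
have df (t : R) : t \in `]-x, x[%R ->
    is_derive t 1 f ((x + t)^-1 + (x - t)^-1 - 2 / x).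
  rewrite in_itv/= => /andP[xt tx].
  have h1 : is_derive (x + t) 1 (@ln R) (x + t)^-1 by apply: is_derive1_ln; lra.
  have h2 : is_derive (x - t) 1 (@ln R) (x - t)^-1 by apply: is_derive1_ln; lra.
  apply: is_derive_eq.
  rewrite /GRing.scale/=; by field; rewrite !gt_eqF//; lra.
have df_ge0 (t : R) : - x < t -> t < x -> 0 <= (x + t)^-1 + (x - t)^-1 - 2 / x.
  move=> xt tx.
  have -> : (x + t)^-1 + (x - t)^-1 - 2 / x = 2 * t ^+ 2 / (x * (x + t) * (x - t)).
    by field; rewrite !gt_eqF//; lra.
  apply: divr_ge0; first by have := sqr_ge0 t; lra.
  by apply: mulr_ge0; [apply: mulr_ge0|]; lra.
have f0s : f 0 <= f s.
  apply: (@ger0_derive1_le_oo _ f (-x) x).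
  - by move=> t tx; have [] := df t tx.
  - move=> t tx; rewrite derive1E; have -> := @derive_val _ _ _ _ _ _ _ (df t tx).
    by move: tx; rewrite in_itv/= => /andP[]; exact: df_ge0.
  - move=> t; rewrite inE => tx; apply: differentiable_continuous.
    by apply/derivable1_diffP; have [] := df t tx.
  - by rewrite in_itv/=; apply/andP; split; lra.
  - by rewrite in_itv/=; apply/andP; split; lra.
  - by [].
move: f0s; rewrite /f addr0 subr0 subrr mulr0 mul0r subr0; lra.
Qed.

(** Midpoint estimate again, for the concave function ln u + 1, the derivative of u ln u. *)
Lemma xlnx_increment_le (R : realType) (x s : R) : 0 <= s -> s < x ->
  (x + s) * ln (x + s) - (x - s) * ln (x - s) <= 2 * s * ln x + 2 * s.
Proof.
move=> s0 sx; have x0 : 0 < x by lra.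
pose f t : R := (x + t) * ln (x + t) - (x - t) * ln (x - t) - 2 * t * (ln x + 1).
have df (t : R) : t \in `]-x, x[%R ->
    is_derive t 1 f (ln (x + t) + ln (x - t) - 2 * ln x).
  rewrite in_itv/= => /andP[xt tx].
  have h1 : is_derive (x + t) 1 (@ln R) (x + t)^-1 by apply: is_derive1_ln; lra.
  have h2 : is_derive (x - t) 1 (@ln R) (x - t)^-1 by apply: is_derive1_ln; lra.
  apply: is_derive_eq.
  rewrite /GRing.scale/=; by field; rewrite !gt_eqF//; lra.
have df_le0 (t : R) : - x < t -> t < x -> ln (x + t) + ln (x - t) - 2 * ln x <= 0.
  move=> xt tx.
  have : ln ((x + t) * (x - t)) <= ln (x * x).
    rewrite ler_ln ?posrE ?mulr_gt0//; [|lra|lra].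
    by have := sqr_ge0 t; rewrite expr2; nra.
  rewrite !lnM ?posrE//; lra.
have f0s : f s <= f 0.
  apply: (@ler0_derive1_le_oo _ f (-x) x).
  - by move=> t tx; have [] := df t tx.
  - move=> t tx; rewrite derive1E; have -> := @derive_val _ _ _ _ _ _ _ (df t tx).
    by move: tx; rewrite in_itv/= => /andP[]; exact: df_le0.
  - move=> t; rewrite inE => tx; apply: differentiable_continuous.
    by apply/derivable1_diffP; have [] := df t tx.
  - by rewrite in_itv/=; apply/andP; split; lra.
  - by rewrite in_itv/=; apply/andP; split; lra.
  - by [].
move: f0s; rewrite /f addr0 subr0 subrr mulr0 mul0r subr0; lra.
Qed.

(** * Krichevsky-Trofimov weights and their comparison with Bernoulli likelihoods *)

(** The rising factorial of 1/2, that is Gamma(a + 1/2) / Gamma(1/2). *)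
Definition half_rising (R : realType) (a : nat) : R :=
  \prod_(i < a) (i%:R + 2^-1).

(* [kt_weight a b] is the Krichevsky-Trofimov probability of a word with [a]
   ones and [b] zeros, i.e. the integral of t^a (1-t)^b against Beta(1/2,1/2). *)
Definition kt_weight (R : realType) (a b : nat) : R :=
  half_rising R a * half_rising R b / (a + b)`!%:R.

Section krichevsky_trofimov.
Context {R : realType}.
Implicit Types a b N k : nat.
Local Notation half_rising := (half_rising R).
Local Notation kt_weight := (kt_weight R).

Lemma half_risingS a : half_rising a.+1 = half_rising a * (a%:R + 2^-1).
Proof. by rewrite /half_rising big_ord_recr. Qed.

Lemma half_rising_gt0 a : 0 < half_rising a.
Proof. by apply: prodr_gt0 => i _; have := ler0n R i; lra. Qed.

Lemma kt_weight_gt0 a b : 0 < kt_weight a b.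
Proof. by rewrite divr_gt0 ?mulr_gt0 ?half_rising_gt0// ltr0n fact_gt0. Qed.

Lemma kt_weightC a b : kt_weight a b = kt_weight b a.
Proof. by rewrite /kt_weight [X in X / _]mulrC addnC. Qed.

(** The sequential prediction rule: after [a] ones and [b] zeros, the next letter is a one with
    probability (a + 1/2)/(a + b + 1). *)
Lemma kt_weightS a b :
  kt_weight a.+1 b = kt_weight a b * (a%:R + 2^-1) / (a + b).+1%:R.
Proof.
rewrite /kt_weight half_risingS addSn factS natrM.
have := ltr0n R (a + b)`!; rewrite fact_gt0 => h.
by field; rewrite !gt_eqF// ltr0n.
Qed.

(* Pascal's rule splits off a factor (k + 1/2) + (N - k + 1/2) = N + 1. *)
Lemma sum_bin_half_rising N :
  \sum_(k < N.+1) 'C(N, k)%:R * (half_rising k * half_rising (N - k)) = N`!%:R.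
Proof.
elim: N => [|N IH].
  by rewrite big_ord1 bin0 /half_rising !big_ord0 !mulr1.
rewrite big_ord_recl bin0 mul1r subn0.
have -> : \sum_(i < N.+1) 'C(N.+1, lift ord0 i)%:R *
      (half_rising (lift ord0 i) * half_rising (N.+1 - lift ord0 i)) =
    \sum_(i < N.+1) 'C(N, i.+1)%:R * (half_rising i.+1 * half_rising (N - i)) +
    \sum_(i < N.+1) 'C(N, i)%:R * (half_rising i.+1 * half_rising (N - i)).
  rewrite -big_split/=; apply: eq_bigr => i _.
  by rewrite /bump add1n subSS binS natrD mulrDl.
rewrite addrA.
have -> : half_rising 0 * half_rising N.+1 +
    \sum_(i < N.+1) 'C(N, i.+1)%:R * (half_rising i.+1 * half_rising (N - i)) =
    \sum_(i < N.+1) 'C(N, i)%:R * (half_rising i * half_rising (N.+1 - i)).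
  rewrite big_ord_recr/= bin_small// mul0r addr0.
  rewrite [RHS]big_ord_recl bin0 mul1r subn0; congr (_ + _).
rewrite -big_split/= factS natrM -IH big_distrr/=; apply: eq_bigr => i _.
rewrite subSn ?leq_ord// !half_risingS.
have -> : N.+1%:R = i%:R + (N - i)%:R + 1 :> R.
  by rewrite -natrD subnKC ?leq_ord// -natr1.
by field.
Qed.

Lemma sum_bin_kt_weight N :
  \sum_(k < N.+1) 'C(N, k)%:R * kt_weight k (N - k) = 1.
Proof.
have h : 0 < N`!%:R :> R by rewrite ltr0n fact_gt0.
rewrite -[RHS](@divff _ N`!%:R) ?gt_eqF// -[X in X / _]sum_bin_half_rising.
rewrite mulr_suml; apply: eq_bigr => k _.
by rewrite /kt_weight subnKC ?leq_ord// !mulrA.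
Qed.

Local Notation xlnx a := (a%:R * ln (a%:R : R)).

Lemma xlnxS_le a : xlnx a.+1 - xlnx a <= ln (a%:R + 2^-1) + 1.
Proof.
(* At [a = 0] the interval [a, a + 1] touches 0, which [xlnx_increment_le] excludes; the claim there
   is ln 2 <= 1. *)
case: a => [|a].
  rewrite ln1 mulr0 mul0r subrr add0r lnV ?posrE//.
  have := @le_ln1Dx R 1; rewrite -[1 + 1]/(2%:R); lra.
have /(_ _ _) := @xlnx_increment_le R (a.+1%:R + 2^-1) 2^-1.
have := ltr0Sn R a => h.
have -> : a.+1%:R + 2^-1 + 2^-1 = a.+2%:R :> R by rewrite -[RHS]natr1; lra.
rewrite addrK; lra.
Qed.

Lemma ln_succ_ge N : (0 < N)%N ->
  1 <= (N%:R + 2^-1) * (ln (N.+1%:R : R) - ln N%:R).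
Proof.
rewrite -(ltr0n R) => N0.
have /(_ _ _) := @ln_ratio_ge R (N%:R + 2^-1) 2^-1.
have -> : N%:R + 2^-1 + 2^-1 = N.+1%:R :> R by rewrite -[RHS]natr1; lra.
rewrite addrK divff// ler_pdivrMr; last lra.
by rewrite mulrC; apply; lra.
Qed.

(** The left side is the logarithm of the largest Bernoulli likelihood of a word with [a] ones and
    [b] zeros. By [xlnxS_le], appending a letter to a word of length N preserves the bound as soon
    as 1 <= (N + 1/2)(ln (N + 1) - ln N), which is [ln_succ_ge]. Words of one letter give equality,
    whence the constant ln 2. *)
Lemma entropy_le_kt_weight a b : (0 < a + b)%N ->
  xlnx a + xlnx b - xlnx (a + b) <=
    ln 2 + 2^-1 * ln (a + b)%:R + ln (kt_weight a b).
Proof.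
pose T a b := xlnx a + xlnx b - xlnx (a + b) <=
    ln 2 + 2^-1 * ln (a + b)%:R + ln (kt_weight a b).
have TC a' b' : T a' b' -> T b' a'.
  by rewrite /T kt_weightC addnC [xlnx a' + _]addrC.
have TS a' b' : (0 < a' + b')%N -> T a' b' -> T a'.+1 b'.
  move=> ab0.
  have kt0 := kt_weight_gt0 a' b'.
  have a0 : 0 < a'%:R + 2^-1 :> R by have := ler0n R a'; lra.
  rewrite /T kt_weightS addSn !lnM ?lnV ?posrE ?invr_gt0 ?mulr_gt0 ?half_rising_gt0//.
  have := xlnxS_le a'; have := ln_succ_ge _ ab0.
  rewrite -[(a' + b').+1%:R]natr1; lra.
(* The induction starts at length one because [ln_succ_ge] excludes N = 0. Ones are appended by
   [TS], zeros by [TS] through the symmetry [TC]. *)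
have T0 k : T k.+1 0%N.
  elim: k => [|k]; last by apply: TS.
  have -> : T 1%N 0%N = (0 <= ln 2 + ln (2^-1 : R)).
    rewrite /T /kt_weight half_risingS /half_rising big_ord0.
    rewrite (_ : (1 + 0)`! = 1)%N// ln1 !(mul0r, mulr0, mulr1, mul1r, divr1, add0r).
    by rewrite oppr0 addr0.
  by rewrite lnV ?posrE// subrr.
have TSb k c : T k.+1 c.
  elim: c => [|c IH]; first exact: T0.
  by apply: (TC); apply: TS; [rewrite addnS | exact: (TC)].
case: a => [|a] ab0; last exact: TSb.
by case: b ab0 => // b _; apply: (TC); exact: (TSb).
Qed.

(* Gibbs' inequality followed by the bound on the entropy. *)
Lemma bernoulli_likelihood_le_kt_weight a b (t : R) : (0 < a + b)%N -> 0 <= t <= 1 ->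
  t ^+ a * (1 - t) ^+ b <= 2 * Num.sqrt (a + b)%:R * kt_weight a b.
Proof.
move=> N0 /andP[t0 t1].
have gt0 : 0 < 2 * Num.sqrt (a + b)%:R * kt_weight a b.
  by apply: mulr_gt0 (kt_weight_gt0 _ _); rewrite mulr_gt0 ?sqrtr_gt0 ?ltr0n.
have N0R : 0 < (a + b)%:R :> R by rewrite ltr0n.
(* The inequality ln y <= y - 1 at y = N u / c, for one of the two letters. The linear terms N u - c
   cancel when both letters are added, since t + (1 - t) = 1. *)
have gibbs (c : nat) (u : R) : 0 <= u -> (c == 0%N) || (0 < u) ->
    exists2 v : R, u ^+ c = expR v & v <= xlnx c - c%:R * ln (a + b)%:R + (a + b)%:R * u - c%:R.
  case: c => [|c] u0 cu.
    by exists 0; rewrite ?expr0 ?expR0// !mul0r; have := mulr_ge0 (ltW N0R) u0; lra.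
  have {u0 cu} u0 : 0 < u by case/orP: cu.
  exists (c.+1%:R * ln u); first by rewrite expRM_natl lnK.
  have c0 : 0 < c.+1%:R :> R by rewrite ltr0n.
  have h : 0 < (a + b)%:R * u / c.+1%:R by rewrite divr_gt0// mulr_gt0.
  have {}h : ln ((a + b)%:R * u / c.+1%:R) <= (a + b)%:R * u / c.+1%:R - 1.
    move: h; set y := _ / _ => y0; have := @le_ln1Dx R (y - 1).
    by rewrite (_ : 1 + (y - 1) = y); [apply|]; lra.
  rewrite ln_div ?lnM ?posrE ?mulr_gt0// in h.
  have := ler_wpM2l (ltW c0) h.
  have : (a + b)%:R * u / c.+1%:R * c.+1%:R = (a + b)%:R * u by rewrite divfK ?gt_eqF.
  move: (_ / _) h => y h <-; move: (ln (a + b)%:R) h => lN h.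
  move: (c.+1%:R : R) h => C h; lra.
(* If a letter of probability 0 occurs in the word, the likelihood is 0. *)
case: (boolP ((a == 0%N) || (0 < t))) => [at0|]; last first.
  rewrite negb_or -leNgt => /andP[a0 t0'].
  have -> : t = 0 by lra.
  by rewrite expr0n (negbTE a0) mul0r ltW.
case: (boolP ((b == 0%N) || (0 < 1 - t))) => [bt0|]; last first.
  rewrite negb_or -leNgt => /andP[b0 t0'].
  have -> : t = 1 by lra.
  by rewrite subrr [0 ^+ b]expr0n (negbTE b0) mulr0 ltW.
have [v -> vle] := gibbs a t t0 at0.
have [|w -> wle] := gibbs b (1 - t) _ bt0; first by rewrite subr_ge0.
have sqrt0 : 0 < Num.sqrt (a + b)%:R :> R by rewrite sqrtr_gt0.
have ln_sqrt : ln (Num.sqrt (a + b)%:R) = 2^-1 * ln (a + b)%:R :> R.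
  rewrite -[in RHS](@sqr_sqrtr _ (a + b)%:R) ?ltW// lnXn ?sqrtr_gt0//.
  by rewrite -(mulr_natl (ln _)) mulrA mulVf ?mul1r.
rewrite -expRD -[leRHS]lnK// ler_expR.
have -> : ln (2 * Num.sqrt (a + b)%:R * kt_weight a b) =
    ln 2 + 2^-1 * ln (a + b)%:R + ln (kt_weight a b).
  by rewrite lnM ?posrE ?kt_weight_gt0 ?mulr_gt0// lnM ?posrE// ln_sqrt.
have := entropy_le_kt_weight _ _ N0.
move: (natrD R a b) vle wle; move: (ln (a + b)%:R) => lN.
move: (a + b)%:R => N -> vle wle; lra.
Qed.

End krichevsky_trofimov.

(** * Hoeffding's smoothing, on generating polynomials *)

(** The probability generating polynomial of a Bernoulli variable of mean [q]. *)
Definition bernoulli_gf (R : realType) (q : R) : {poly R} := (1 - q)%:P + q *: 'X.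

(** On polynomials of degree at most [N], the linear functional sending X^k to [g k]. On a product
    of at most [N] factors [bernoulli_gf] with means in [0, 1], it is the expectation of [g] at the
    number of successes in independent trials. *)
Definition umbral (R : realType) (g : nat -> R) (N : nat) (Q : {poly R}) : R :=
  \sum_(k < N.+1) Q`_k * g k.

Section hoeffding_smoothing.
Context {R : realType}.
Implicit Types (q r : R) (A B : {poly R}).
Local Notation bernoulli_gf := (@bernoulli_gf R).

Local Notation nneg A := (forall k, 0 <= A`_k).

Lemma nneg_coefM A B : nneg A -> nneg B -> nneg (A * B).
Proof. by move=> A0 B0 k; rewrite coefM sumr_ge0// => i _; rewrite mulr_ge0. Qed.

Lemma bernoulli_gf_nneg q : 0 <= q <= 1 -> nneg (bernoulli_gf q).
Proof.
move=> /andP[q0 q1] k; rewrite coefD coefC coefZ coefX.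
by rewrite addr_ge0 ?mulr_ge0//; case: ifP; rewrite ?subr_ge0.
Qed.

Lemma prod_bernoulli_gf_nneg (s : seq R) : {in s, forall q, 0 <= q <= 1} ->
  nneg (\prod_(q <- s) bernoulli_gf q).
Proof.
move=> s01; rewrite big_seq; apply: (big_ind (fun A => nneg A)).
- by move=> k; rewrite coef1 ler0n.
- exact: nneg_coefM.
- by move=> q /s01; exact: bernoulli_gf_nneg.
Qed.

Lemma size_bernoulli_gf q : (size (bernoulli_gf q) <= 2)%N.
Proof.
rewrite (leq_trans (size_polyD _ _))// geq_max (leq_trans (size_polyC_leq1 _))//.
by rewrite (leq_trans (size_scale_leq _ _))// size_polyX.
Qed.

Lemma size_prod_bernoulli_gf (s : seq R) :
  (size (\prod_(q <- s) bernoulli_gf q)%R <= (size s).+1)%N.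
Proof.
elim: s => [|q s IH]; first by rewrite big_nil size_poly1.
rewrite big_cons (leq_trans (size_polyMleq _ _))// -subn1 leq_subLR.
by rewrite (leq_trans (leq_add (size_bernoulli_gf q) IH))// add1n.
Qed.

Variables (g : nat -> R) (N : nat).
Local Notation L := (umbral R g N).

Lemma umbralD P Q : L (P + Q) = L P + L Q.
Proof. by rewrite /umbral -big_split; apply: eq_bigr => k _; rewrite coefD mulrDl. Qed.

Lemma umbralZ c P : L (c *: P) = c * L P.
Proof. by rewrite /umbral big_distrr; apply: eq_bigr => k _; rewrite coefZ /= mulrA. Qed.

Lemma umbral_sum (I : Type) (s : seq I) (Pr : pred I) (F : I -> {poly R}) :
  L (\sum_(i <- s | Pr i) F i) = \sum_(i <- s | Pr i) L (F i).
Proof.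
apply: (big_morph L umbralD).
by rewrite /umbral big1// => k _; rewrite coef0 mul0r.
Qed.

Lemma umbralXn k : (k <= N)%N -> L 'X^k = g k.
Proof.
rewrite -ltnS => kN; rewrite /umbral (bigD1 (Ordinal kN))//= coefXn eqxx mul1r.
rewrite big1 ?addr0// => i ik; rewrite coefXn.
by rewrite -[k]/(val (Ordinal kN)) val_eqE (negbTE ik) mul0r.
Qed.

Hypothesis g_convex : forall k, (k.+2 <= N)%N -> 0 <= g k.+2 - 2 * g k.+1 + g k.

(** The functional maps X^k (X - 1)^2 to the second difference of [g] at k. As the size exceeds the
    degree by one, the bound on [size A] keeps k + 2 at most [N]. *)
Lemma umbral_sqr_ge0 A : nneg A -> (size A < N)%N ->
  0 <= L (A * ('X - 1) ^+ 2).
Proof.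
move=> A0 sA; rewrite -[A in A * _]coefK poly_def mulr_suml umbral_sum.
apply: sumr_ge0 => k _; rewrite -scalerAl umbralZ mulr_ge0//.
have kN : (k.+2 <= N)%N by rewrite (leq_trans _ sA)// ltnS.
have -> : 'X^k * ('X - 1) ^+ 2 = 'X^(k.+2) + (-2) *: 'X^(k.+1) + 'X^k :> {poly R}.
  by rewrite -!mul_polyC !(exprS _ k.+1) !(exprS _ k); ring.
rewrite !umbralD umbralZ !umbralXn ?(ltnW kN)// 1?ltnW 1?ltnW//.
by have := g_convex k kN; rewrite mulNr.
Qed.

(** Moving the means [q1], [q2] to [r], [q1 + q2 - r] keeps their sum and changes the product of the
    two factors by (r - q1)(q2 - r)(X - 1)^2. *)
Lemma umbral_smooth2 A q1 q2 r : nneg A -> (size A < N)%N ->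
  0 <= (r - q1) * (q2 - r) ->
  L (A * (bernoulli_gf q1 * bernoulli_gf q2)) <=
  L (A * (bernoulli_gf r * bernoulli_gf (q1 + q2 - r))).
Proof.
move=> A0 sA rq.
have -> : A * (bernoulli_gf r * bernoulli_gf (q1 + q2 - r)) =
    A * (bernoulli_gf q1 * bernoulli_gf q2) +
    ((r - q1) * (q2 - r)) *: (A * ('X - 1) ^+ 2).
  by rewrite /bernoulli_gf -!mul_polyC; ring.
by rewrite umbralD umbralZ lerDl mulr_ge0// umbral_sqr_ge0.
Qed.

Lemma exists_ge_mean (s : seq R) r : s != [::] -> r * (size s)%:R <= \sum_(q <- s) q ->
  exists2 q, q \in s & r <= q.
Proof.
move=> s0 rs; apply/hasP; apply: contraT => /hasPn h.
have : \sum_(q <- s) q < r * (size s)%:R.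
  rewrite -[X in r * X%:R]count_predT -sum1_count natr_sum mulr_sumr.
  case: s s0 h {rs} => // a s _ h; rewrite !big_cons ltr_leD//.
    by rewrite mulr1 ltNge h ?mem_head.
  rewrite big_seq [leRHS]big_seq; apply: ler_sum => q qs.
  by rewrite mulr1 leNgt; apply/negP => /ltW; apply/negP/h; rewrite inE qs orbT.
by rewrite ltNge rs.
Qed.

(* Hoeffding: two factors are replaced at a time, one of them becoming the
   factor of the mean. *)
Lemma umbral_prod_le A (s : seq R) r : nneg A ->
  (size A + size s <= N.+1)%N -> {in s, forall q, 0 <= q <= 1} ->
  r * (size s)%:R = \sum_(q <- s) q ->
  L (A * \prod_(q <- s) bernoulli_gf q) <= L (A * bernoulli_gf r ^+ size s).
Proof.
move En : (size s) => n; elim: n s A En => [|n IH] s A.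
  by move=> /size0nil ->; rewrite big_nil expr0.
case: s => [//|p s] [sn] A0 sA s01 sr.
have p01 : 0 <= p <= 1 by apply: s01; rewrite mem_head.
case: n IH sn sA sr => [|n] IH sn sA sr.
  move: sr; rewrite (size0nil sn) !big_seq1 mulr1 => <-.
  by rewrite expr1.
have s0 : s != [::] by rewrite -size_eq0 sn.
(* Since the average is [r], some other mean lies on the side of [r] opposite to [p]. When [p > r],
   it is found by applying [exists_ge_mean] to the negated list. *)
have [q qs rq] : exists2 q, q \in s & (p <= r <= q) || (q <= r <= p).
  move: sr; rewrite big_cons => sr.
  have [pr|rp] := leP p r.
    have [|q qs rq] := exists_ge_mean s r s0; last by exists q; rewrite ?rq.
    by move: sr; rewrite sn -(natr1 n.+1); lra.
  have [||q' /mapP[q qs ->] rq] := exists_ge_mean (map -%R s) (- r).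
  - by rewrite -size_eq0 size_map size_eq0.
  - rewrite big_map sumrN size_map.
    by move: sr; rewrite sn -(natr1 n.+1); lra.
  - by exists q => //; move: rq; rewrite lerN2 => ->; rewrite (ltW rp) orbT.
have q01 : 0 <= q <= 1 by apply: s01; rewrite inE qs orbT.
have r01 : 0 <= r <= 1 by lra.
have sub q' : q' \in rem q s -> 0 <= q' <= 1.
  by move=> /mem_rem q's; apply: s01; rewrite inE q's orbT.
have srem : size (rem q s) = n by rewrite size_rem// sn.
rewrite big_cons (perm_big _ (perm_to_rem qs))/= big_cons.
set B := \prod_(j <- rem q s) _.
have -> : A * (bernoulli_gf p * (bernoulli_gf q * B)) =
   (A * B) * (bernoulli_gf p * bernoulli_gf q) by ring.
apply: le_trans (umbral_smooth2 (A * B) p q r _ _ _) _.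
- exact: nneg_coefM _ _ A0 (prod_bernoulli_gf_nneg _ sub).
- apply: (@leq_ltn_trans (size A + n)%N).
    rewrite (leq_trans (size_polyMleq _ _))// -subn1 leq_subLR addnCA leq_add2l.
    by rewrite add1n -srem size_prod_bernoulli_gf.
  by rewrite -ltnS (leq_trans _ sA)// !addnS.
- by case/orP: rq => /andP[h1 h2]; [apply: mulr_ge0|apply: mulr_le0]; lra.
(* The factor of [r] joins [A]. The mean [p + q - r], which lies between [p] and [q], returns to the
   list, now shorter by one and still of average [r]. *)
have -> : (A * B) * (bernoulli_gf r * bernoulli_gf (p + q - r)) =
    (A * bernoulli_gf r) * \prod_(j <- p + q - r :: rem q s) bernoulli_gf j.
  by rewrite big_cons -/B; ring.
rewrite [X in _ <= L (A * X)]exprS mulrA; apply: IH.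
- by rewrite /= srem.
- exact: nneg_coefM _ _ A0 (bernoulli_gf_nneg _ r01).
- apply: leq_trans sA; rewrite -(addSnnS (size A) n.+1) leq_add2r.
  rewrite (leq_trans (size_polyMleq _ _))// -subn1 leq_subLR add1n.
  by rewrite -addn2 leq_add2l size_bernoulli_gf.
- move=> q'; rewrite inE => /predU1P[->|]; last exact: sub.
  by lra.
- move: sr; rewrite !big_cons (perm_big _ (perm_to_rem qs))/= big_cons.
  by rewrite -(natr1 n.+1); lra.
Qed.

End hoeffding_smoothing.

(* For independent Bernoulli variables of means [q k], the probability that
   those equal to 1 are exactly the ones indexed by [B]. *)
Definition bernoulli_pattern (S : comNzRingType) (K : finType) (q : K -> S)
    (B : {set K}) : S :=
  \prod_k (if k \in B then q k else 1 - q k).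

(** Distributivity, [B] being the set of factors from which the term in [c] is chosen. The ring is
    general because the expansion serves over polynomials, with [c] = X and [d] = 1, as well as over
    the reals. *)
Lemma prod_affine_bernoulli_pattern (S : comNzRingType) (K : finType) (q : K -> S) (c d : S) :
  \prod_k (q k * c + (1 - q k) * d) =
  \sum_(B : {set K}) bernoulli_pattern S K q B * (c ^+ #|B| * d ^+ (#|K| - #|B|)).
Proof.
rewrite bigA_distr; apply: eq_big => // B _.
have -> : c ^+ #|B| * d ^+ (#|K| - #|B|) = \prod_k (if k \in B then c else d).
  rewrite [RHS](bigID (mem B))/= (eq_bigr (fun=> c)) => [|k ->//].
  rewrite [X in _ = _ * X](eq_bigr (fun=> d)) => [|k /negbTE ->//].
  rewrite !prodr_const; congr (_ * _ ^+ _).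
  by rewrite -(cardC (mem B)) addKn; apply: eq_card.
rewrite -big_split/=; apply: eq_bigr => k _.
by case: ifP.
Qed.

(** * The Krichevsky-Trofimov mixture under independent Bernoulli variables *)

Section mixture.
Context {R : realType} (K : finType).
Implicit Types (q : K -> R) (r : R).
Local Notation pattern := (bernoulli_pattern R K).

Lemma bernoulli_pattern_ge0 q B : (forall k, 0 <= q k <= 1) -> 0 <= pattern q B.
Proof.
move=> q01; apply: prodr_ge0 => k _.
by case: ifP => _; have /andP[h1 h2] := q01 k; rewrite ?subr_ge0.
Qed.

Lemma bernoulli_pattern_le1 q B : (forall k, 0 <= q k <= 1) -> pattern q B <= 1.
Proof.
move=> q01; apply: prodr_ile1 => k _; have /andP[h1 h2] := q01 k.
by case: ifP; rewrite ?h1// subr_ge0 h2 lerBlDr lerDl.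
Qed.

(** In the product of the [bernoulli_gf R (q k)], the coefficient of X^j collects the patterns of
    cardinality j; [umbral_prod_le] compares it with the power whose coefficients are binomial
    probabilities. *)
Lemma sum_bernoulli_pattern_le (g : nat -> R) q r :
  (forall k, (k.+2 <= #|K|)%N -> 0 <= g k.+2 - 2 * g k.+1 + g k) ->
  (forall k, 0 <= q k <= 1) -> r * #|K|%:R = \sum_k q k ->
  \sum_(B : {set K}) pattern q B * g #|B| <=
  \sum_(k < #|K|.+1) 'C(#|K|, k)%:R * (r ^+ k * (1 - r) ^+ (#|K| - k)) * g k.
Proof.
move=> gconv q01 qr.
have : umbral R g #|K| (1 * \prod_(p <- map q (enum K)) bernoulli_gf R p) <=
       umbral R g #|K| (1 * bernoulli_gf R r ^+ size (map q (enum K))).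
  apply: umbral_prod_le => //.
  - by move=> k; rewrite coef1 ler0n.
  - by rewrite size_map -cardE size_poly1 add1n.
  - by move=> _ /mapP[k _ ->]; exact: q01.
  - by rewrite size_map -cardE big_map big_enum.
rewrite !mul1r size_map -cardE big_map big_enum/=.
have -> : \prod_k bernoulli_gf R (q k) =
    \sum_(B : {set K}) pattern q B *: 'X^#|B|.
  under eq_bigr => k _.
    have -> : bernoulli_gf R (q k) = (q k)%:P * 'X + (1 - (q k)%:P) * 1.
      by rewrite /bernoulli_gf -mul_polyC rmorphB rmorph1 mulr1 addrC.
    over.
  rewrite prod_affine_bernoulli_pattern; apply: eq_bigr => B _.
  rewrite expr1n mulr1 -mul_polyC; congr (_ * _).
  rewrite [RHS]rmorph_prod; apply: eq_bigr => k _.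
  by case: ifP => // _; rewrite rmorphB rmorph1.
have -> : bernoulli_gf R r ^+ #|K| =
    \sum_(k < #|K|.+1) ('C(#|K|, k)%:R * (r ^+ k * (1 - r) ^+ (#|K| - k))) *: 'X^k.
  rewrite /bernoulli_gf exprDn; apply: eq_bigr => k _.
  rewrite -!mul_polyC exprMn !rmorphM /= rmorph_nat !rmorphXn -mulr_natl.
  by ring.
rewrite !umbral_sum.
have eqW (x y : R) : x = y -> x <= y by move=> ->.
move=> le; apply: le_trans (eqW _ _ _) (le_trans le (eqW _ _ _)).
  by apply: eq_bigr => B _; rewrite umbralZ umbralXn ?max_card.
by apply: eq_bigr => k _; rewrite umbralZ umbralXn ?leq_ord.
Qed.

(* Likelihood ratio of the Krichevsky-Trofimov mixture to Bernoulli(r), on a word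
   of length [N] with [k] ones. *)
Definition kt_ratio (N : nat) r (k : nat) : R :=
  kt_weight R k (N - k) / (r ^+ k * (1 - r) ^+ (N - k)).

Lemma kt_ratio_ge0 N r k : 0 < r < 1 -> 0 <= kt_ratio N r k.
Proof.
move=> /andP[r0 r1]; rewrite divr_ge0 ?(ltW (kt_weight_gt0 _ _))//.
by rewrite mulr_ge0 ?exprn_ge0 ?subr_ge0// ltW.
Qed.

(** With b = N - k - 2, s = k + 1/2 and t = b + 1/2, the second difference is a positive factor
    times s(s + 1)(1 - r)^2 - 2 s t r (1 - r) + t(t + 1) r^2, which is (s(1 - r) - t r)^2 + s(1 -
    r)^2 + t r^2. *)
Lemma kt_ratio_convex N r k : 0 < r < 1 -> (k.+2 <= N)%N ->
  0 <= kt_ratio N r k.+2 - 2 * kt_ratio N r k.+1 + kt_ratio N r k.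
Proof.
move=> /andP[r0 r1] kN; have [b ->] : exists b, N = (k + b).+2.
  by exists (N - k.+2)%N; rewrite -!addSn subnKC.
have r'0 : 0 < 1 - r by rewrite subr_gt0.
have e2 : ((k + b).+2 - k.+2 = b)%N by rewrite -!addSn addKn.
have e1 : ((k + b).+2 - k.+1 = b.+1)%N by rewrite -addSn -addnS addKn.
have e0 : ((k + b).+2 - k = b.+2)%N by rewrite -!addnS addKn.
rewrite /kt_ratio e2 e1 e0 /kt_weight !half_risingS.
have -> : (k.+2 + b = (k + b).+2)%N by rewrite !addSn.
have -> : (k.+1 + b.+1 = (k + b).+2)%N by rewrite addSn addnS.
have -> : (k + b.+2 = (k + b).+2)%N by rewrite !addnS.
set F := _`!%:R; set s := k%:R + 2^-1; set t := b%:R + 2^-1.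
have F0 : 0 < F by rewrite ltr0n fact_gt0.
have s0 : 0 <= s by rewrite addr_ge0.
have t0 : 0 <= t by rewrite addr_ge0.
have -> : k.+1%:R + 2^-1 = s + 1 :> R by rewrite -natr1 /s; ring.
have -> : b.+1%:R + 2^-1 = t + 1 :> R by rewrite -natr1 /t; ring.
have ck0 := @half_rising_gt0 R k; have cb0 := @half_rising_gt0 R b.
rewrite !exprS; set rk := r ^+ k; set rb := (1 - r) ^+ b.
have rk0 : 0 < rk by rewrite exprn_gt0.
have rb0 : 0 < rb by rewrite exprn_gt0.
set G := half_rising R k * half_rising R b / F / (rk * rb) / (r * (1 - r)) ^+ 2.
rewrite [X in 0 <= X](_ : _ =
   G * ((s * (1 - r) - t * r) ^+ 2 + s * (1 - r) ^+ 2 + t * r ^+ 2)).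
  apply: mulr_ge0.
    have [G1 G2] : 0 < rk * rb /\ 0 < r * (1 - r) by rewrite !mulr_gt0.
    apply/ltW/divr_gt0; last exact: exprn_gt0.
    by apply: divr_gt0 => //; apply: divr_gt0 => //; exact: mulr_gt0.
  by rewrite !addr_ge0 ?sqr_ge0// mulr_ge0 ?sqr_ge0.
by rewrite /G; field; rewrite !gt_eqF.
Qed.

Lemma sum_pattern_kt_ratio_le1 q r : (0 < #|K|)%N -> 0 < r < 1 ->
  (forall k, 0 <= q k <= 1) -> r * #|K|%:R = \sum_k q k ->
  \sum_(B : {set K}) pattern q B * kt_ratio #|K| r #|B| <= 1.
Proof.
move=> K0 r01 q01 qr.
rewrite -(sum_bin_kt_weight #|K|).
apply: le_trans (sum_bernoulli_pattern_le _ _ _ _ q01 qr) _.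
  by move=> k kK; exact: kt_ratio_convex.
under eq_bigr => k _ do rewrite -mulrA.
rewrite le_eqVlt; apply/orP; left; apply/eqP.
apply: eq_bigr => k _; congr (_ * _).
rewrite /kt_ratio mulrC divfK//; case/andP: r01 => r0 r1.
by rewrite mulf_neq0// expf_neq0// ?gt_eqF// ?subr_gt0.
Qed.

End mixture.

(** * Pointwise bound on the exponential of the divergence *)

Section pointwise_bound.
Context {R : realType}.
Implicit Types (x y r u v : R).

Lemma klterm_neq0 x y : y != 0 -> klterm x y = (x * ln (x / y))%:E.
Proof. by rewrite /klterm => /negbTE ->; case: eqVneq => // ->; rewrite mul0r. Qed.

(* Convexity, from the tangent at the weighted mean. *)
Lemma expR_conv_le x u v : 0 <= x <= 1 ->
  expR (x * u + (1 - x) * v) <= x * expR u + (1 - x) * expR v.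
Proof.
move=> /andP[x0 x1]; set w := x * u + (1 - x) * v.
have tangent z : expR w * (1 + (z - w)) <= expR z.
  have -> : expR z = expR w * expR (z - w) by rewrite -expRD; congr expR; ring.
  by rewrite ler_pM2l ?expR_gt0// expR_ge1Dx.
have x1' : 0 <= 1 - x by rewrite subr_ge0.
apply: le_trans (lerD (ler_wpM2l x0 (tangent u)) (ler_wpM2l x1' (tangent v))).
by rewrite le_eqVlt; apply/orP; left; apply/eqP; rewrite /w; ring.
Qed.

Variables (K : finType) (x : K -> R) (t : R).
Hypotheses (K0 : (0 < #|K|)%N) (x01 : forall k, 0 <= x k <= 1).
Hypothesis tx : t * #|K|%:R = \sum_k x k.

Lemma mean_01 : 0 <= t <= 1.
Proof.
have N0 : 0 < #|K|%:R :> R by rewrite ltr0n.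
apply/andP; split.
  by rewrite -(pmulr_lge0 _ N0) tx; apply: sumr_ge0 => k _; case/andP: (x01 k).
rewrite -(ler_pM2r N0) tx mul1r -sum1_card natr_sum; apply: ler_sum => k _.
by case/andP: (x01 k).
Qed.

Lemma mean_eq0 k : t = 0 -> x k = 0.
Proof.
move=> t0; have /esym/eqP := tx; rewrite t0 mul0r psumr_eq0; last first.
  by move=> j _; case/andP: (x01 j).
by move=> /allP/(_ k); rewrite mem_index_enum => /(_ isT)/eqP.
Qed.

Lemma mean_eq1 k : t = 1 -> x k = 1.
Proof.
move=> t1; have /eqP : \sum_k (1 - x k) = 0.
  by rewrite sumrB sumr_const -tx t1 mul1r subrr.
rewrite psumr_eq0; last by move=> j _; case/andP: (x01 j); rewrite subr_ge0.
by move=> /allP/(_ k); rewrite mem_index_enum => /(_ isT); rewrite subr_eq0 eq_sym => /eqP.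
Qed.

Lemma expR_kl_le (r : R) : 0 < r < 1 ->
  exists2 d, kl t r = d%:E &
    expR (#|K|%:R * d) <= 2 * Num.sqrt #|K|%:R *
      \sum_(B : {set K}) bernoulli_pattern R K x B * kt_ratio #|K| r #|B|.
Proof.
move=> /andP[r0 r1]; have r1' : 0 < 1 - r by rewrite subr_gt0.
have /andP[t0 t1] := mean_01; have t1' : 0 <= 1 - t by rewrite subr_ge0.
set c := t / r; set c' := (1 - t) / (1 - r).
exists (t * ln c + (1 - t) * ln c').
  by rewrite /kl !klterm_neq0 ?gt_eqF.
have -> : #|K|%:R * (t * ln c + (1 - t) * ln c') =
    \sum_k (x k * ln c + (1 - x k) * ln c').
  rewrite big_split/= -!mulr_suml sumrB sumr_const -tx; ring.
rewrite expR_sum; apply: (@le_trans _ _ (\prod_k (x k * c + (1 - x k) * c'))).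
  apply: ler_prod => k _; rewrite expR_ge0/=.
  (* For t = 0 or t = 1 one of [c], [c'] is 0, and exp (ln 0) = 0 fails because ln 0 has the default
     value 0. All [x k] then equal t, so that this logarithm has coefficient 0. *)
  have [t_eq0|t_neq0] := eqVneq t 0.
    rewrite mean_eq0// /c /c' t_eq0 !mul0r !add0r !subr0 !mul1r lnK//.
    by rewrite posrE invr_gt0.
  have [t_eq1|t_neq1] := eqVneq t 1.
    rewrite mean_eq1// /c /c' t_eq1 subrr !mul0r !addr0 !mul1r lnK//.
    by rewrite posrE invr_gt0.
  rewrite (le_trans (expR_conv_le _ _ _ (x01 k)))// !lnK// posrE divr_gt0//.
    by rewrite subr_gt0 lt_neqAle t_neq1.
  by rewrite lt_def t_neq0.
rewrite prod_affine_bernoulli_pattern mulr_sumr; apply: ler_sum => B _.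
rewrite [leRHS]mulrCA ler_wpM2l ?bernoulli_pattern_ge0//.
rewrite /kt_ratio !expr_div_n mulrACA -invfM mulrA ler_wpM2r//.
  by rewrite invr_ge0 mulr_ge0// exprn_ge0// ltW.
have BK : (#|B| + (#|K| - #|B|))%N = #|K| by rewrite subnKC// max_card.
rewrite -[X in Num.sqrt X%:R]BK; apply: bernoulli_likelihood_le_kt_weight.
  by rewrite BK.
by rewrite t0.
Qed.

End pointwise_bound.

(** * Expectation of a product of functions of independent variables *)

(** Monotone convergence, with the pointwise limit given as [g] instead of [limn]. *)
Lemma cvg_ge0_integral d (T : measurableType d) (R : realType)
    (mu : {measure set T -> \bar R}) (g_ : nat -> T -> \bar R) (g : T -> \bar R) :
  (forall n, measurable_fun setT (g_ n)) -> (forall n x, (0 <= g_ n x)%E) ->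
  (forall x, {homo (fun n => g_ n x) : n m / (n <= m)%N >-> (n <= m)%E}) ->
  (forall x, g_ n x @[n --> \oo] --> g x) ->
  (\int[mu]_x g_ n x @[n --> \oo] --> \int[mu]_x g x)%E.
Proof.
move=> mg g0 nd gcvg.
rewrite (_ : (\int[mu]_x g x)%E = (\int[mu]_x limn (g_ ^~ x))%E); last first.
  by apply: eq_integral => x _; apply/esym/cvg_lim.
by apply: cvg_monotone_convergence => // x _; exact: nd.
Qed.

Section integral_comp_mul.
Local Open Scope ereal_scope.
Context d1 d2 (Om : measurableType d1) (T : measurableType d2) {R : realType}.
Variables (mu : {measure set Om -> \bar R}) (nu : {measure set T -> \bar R}).
Variables (Z : Om -> T) (mZ : measurable_fun setT Z).
Variables (h : Om -> R) (mh : measurable_fun setT h) (h0 : forall w, (0 <= h w)%R).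
Variables (c : R) (c0 : (0 <= c)%R).

Import HBNNSimple.

(* Both sides are integrals of [f] against a measure: the image under [Z] of
   the measure of density [h], and [c * nu]. *)
Lemma ge0_integral_comp_mul :
  (forall A, measurable A ->
    \int[mu]_w (\1_A (Z w) * h w)%:E = c%:E * nu A) ->
  forall f : T -> R, measurable_fun setT f -> (forall z, (0 <= f z)%R) ->
    \int[mu]_w (f (Z w) * h w)%:E = c%:E * \int[nu]_z (f z)%:E.
Proof.
move=> H f mf f0.
have mfE : measurable_fun [set: T] (fun z => (f z)%:E : \bar R) by exact/measurable_EFinP.
have fE0 z : setT z -> 0 <= (f z)%:E by rewrite lee_fin.
pose f_ := nnsfun_approx measurableT mfE.
have f_cvg z : EFin \o f_^~ z @ \oo --> (f z)%:E by exact: cvg_nnsfun_approx.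
have f_nd z : {homo (fun n => f_ n z) : n m / (n <= m)%N >-> (n <= m)%R}.
  by move=> n m nm; exact/lefP/nd_nnsfun_approx.
(* For r < 0 the level set is empty, [f_ n] being nonnegative. *)
have ind_ge0 n r w : (0 <= r * (\1_(f_ n @^-1` [set r]) (Z w) * h w))%R.
  have [r0|r0] := leP 0%R r; first by rewrite !mulr_ge0.
  by rewrite preimage_nnfun0// indic0 mul0r mulr0.
(* Linearity gives the identity for the simple approximations [f_ n]; monotone convergence on both
   sides then carries it to [f]. *)
have simple n : \int[mu]_w (f_ n (Z w) * h w)%:E = c%:E * \int[nu]_z (f_ n z)%:E.
  rewrite integralT_nnsfun sintegralE ge0_mule_fsumr; last first.
    by move=> r; exact: nnsfun_mulemu_ge0.
  transitivity (\int[mu]_w (\sum_(r \in range (f_ n))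
      (r * (\1_(f_ n @^-1` [set r]) (Z w) * h w))%:E)).
    apply: eq_integral => w _; rewrite fsumEFin//; congr EFin.
    rewrite fimfunE mulr_fsuml; apply: eq_fsbigr => r _.
    by rewrite mulrA.
  have mind r : measurable_fun [set: Om] (fun w => \1_(f_ n @^-1` [set r]) (Z w) * h w)%R.
    by apply: measurable_funM => //; exact: measurableT_comp.
  rewrite ge0_integral_fsum//; last 2 first.
  - by move=> r; apply/measurable_EFinP/measurable_funM.
  - by move=> r w _; rewrite lee_fin.
  apply: eq_fsbigr => r _; have [r0|r0] := leP 0%R r; last first.
    rewrite preimage_nnfun0// measure0 !mule0 integral0_eq// => w _.
    by rewrite indic0 mul0r mulr0.
  under eq_integral do rewrite EFinM.
  rewrite ge0_integralZl//; last 2 first.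
  - exact/measurable_EFinP.
  - by move=> w _; rewrite lee_fin mulr_ge0.
  by rewrite H// muleCA.
have cvgl : \int[mu]_w (f_ n (Z w) * h w)%:E @[n --> \oo] --> \int[mu]_w (f (Z w) * h w)%:E.
  apply: cvg_ge0_integral.
  - move=> n; apply/measurable_EFinP/measurable_funM => //.
    exact: measurableT_comp.
  - by move=> n w; rewrite lee_fin mulr_ge0.
  - by move=> w m n mn; rewrite lee_fin ler_wpM2r// f_nd.
  - by move=> w; under eq_fun do rewrite EFinM; rewrite EFinM; exact/cvgeZr/f_cvg.
have cvgr : c%:E * \int[nu]_z (f_ n z)%:E @[n --> \oo] --> c%:E * \int[nu]_z (f z)%:E.
  apply: cvgeZl => //; apply: cvg_ge0_integral.
  - by move=> n; exact/measurable_EFinP.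
  - by move=> n z; rewrite lee_fin.
  - by move=> z m n mn; rewrite lee_fin f_nd.
  - exact: f_cvg.
move: cvgl; under eq_fun do rewrite simple; move=> cvgl.
by apply: (cvg_unique _ cvgl cvgr).
Qed.
End integral_comp_mul.

Section independence.
Local Open Scope ereal_scope.
Context d1 d2 (Om : measurableType d1) (T : measurableType d2) {R : realType}.
Variables (K : finType) (P : probability Om R) (p : K -> probability T R).
Variables (Z : K -> Om -> T) (mZ : forall k, measurable_fun setT (Z k)).
Hypothesis indep : forall A : K -> set T, (forall k, measurable (A k)) ->
  P [set w | forall k, A k (Z k w)] = \prod_k p k (A k).

(** [indep] is the case of indicators. They are replaced by the functions [f k] one coordinate at a
    time, each time by [ge0_integral_comp_mul] with the product of the other factors as density. *)
Lemma integral_prod_indep (f : K -> T -> R) :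
  (forall k, measurable_fun setT (f k)) -> (forall k z, (0 <= f k z <= 1)%R) ->
  \int[P]_w (\prod_k f k (Z k w))%:E = (\prod_k fine (\int[p k]_z (f k z)%:E))%:E.
Proof.
move=> mf f01.
have f0 k z : (0 <= f k z)%R by case/andP: (f01 k z).
pose I k := fine (\int[p k]_z (f k z)%:E).
have I0 k : (0 <= I k)%R.
  by apply: fine_ge0; apply: integral_ge0 => z _; rewrite lee_fin.
have IE k : \int[p k]_z (f k z)%:E = (I k)%:E.
  rewrite fineK// ge0_fin_numE; last first.
    by apply: integral_ge0 => z _; rewrite lee_fin.
  apply: (@le_lt_trans _ _ (\int[p k]_z (1%:E))).
    apply: ge0_le_integral => //.
    - by move=> z _; rewrite lee_fin.
    - exact/measurable_EFinP.
    - by move=> z _; rewrite lee_fin; case/andP: (f01 k z).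
  rewrite integral_cst// mul1e.
  exact: le_lt_trans (probability_le1 (p k) measurableT) (ltry _).
(* Coordinates in [s] already carry [f], the others an indicator. The sets [A] stay arbitrary
   throughout the induction on [s]. *)
pose F (s : seq K) (A : K -> set T) k w : R :=
  if k \in s then f k (Z k w) else \1_(A k) (Z k w).
pose J (s : seq K) (A : K -> set T) k : R :=
  if k \in s then I k else fine (p k (A k)).
have F0 s A k w : (0 <= F s A k w)%R by rewrite /F; case: ifP.
have J0 s A k : (0 <= J s A k)%R by rewrite /J; case: ifP => // _; exact: fine_ge0.
have mF s A : (forall k, measurable (A k)) -> forall k, measurable_fun setT (F s A k).
  move=> mA k; rewrite /F; case: (k \in s); first exact: measurableT_comp.
  by apply: measurableT_comp.
have main s A : (forall k, measurable (A k)) ->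
    \int[P]_w (\prod_k F s A k w)%:E = (\prod_k J s A k)%:E.
  elim: s A => [|k0 s IH] A mA.
    pose S := [set w | forall k, A k (Z k w)].
    have mS : measurable S.
      rewrite (_ : S = \bigcap_(k in [set: K]) (Z k @^-1` A k)); last first.
        by apply/seteqP; split => [w Sw k _|w Sw k]; exact: Sw.
      apply: fin_bigcap_measurable => // k _.
      by rewrite -[_ @^-1` _]setTI; exact: mZ.
    transitivity (\int[P]_w (\1_S w)%:E).
      apply: eq_integral => w _; congr EFin; rewrite /F indicE.
      have [Sw|nSw] := pselect (S w).
        by rewrite mem_set// big1// => k _; rewrite indicE mem_set//; exact: Sw.
      have [k nk] : exists k, ~ A k (Z k w) by apply/existsNP.
      by rewrite memNset// (bigD1 k)//= indicE memNset// mul0r.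
    rewrite integral_indic// setIT; transitivity (\prod_k p k (A k)); first exact: indep.
    rewrite (big_morph EFin EFinM erefl); apply: eq_bigr => k _.
    by rewrite /J/= fineK// fin_num_measure.
  have [k0s|k0s] := boolP (k0 \in s).
    have E (k : K) : (k \in k0 :: s) = (k \in s).
      by rewrite inE; case: eqVneq => [->|].
    under eq_integral do under eq_bigr do rewrite /F E.
    by rewrite [LHS]IH//; congr EFin; apply: eq_bigr => k _; rewrite /J E.
  pose h w := (\prod_(k | k != k0) F s A k w)%R.
  pose c := (\prod_(k | k != k0) J s A k)%R.
  have E (k : K) : k != k0 -> (k \in k0 :: s) = (k \in s).
    by rewrite inE => /negbTE ->.
  transitivity (\int[P]_w (f k0 (Z k0 w) * h w)%:E).
    apply: eq_integral => w _; congr EFin; rewrite (bigD1 k0)//=; congr (_ * _)%R.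
      by rewrite /F mem_head.
    by apply: eq_bigr => k kk0; rewrite /F E.
  rewrite (@ge0_integral_comp_mul _ _ _ _ _ P (p k0) (Z k0) (mZ k0) h _ _ c)//.
  - rewrite IE -EFinM; congr EFin; rewrite [RHS](bigD1 k0)//= mulrC; congr (_ * _)%R.
      by rewrite /J mem_head.
    by apply: eq_bigr => k kk0; rewrite /J E.
  - rewrite /h; under eq_fun do rewrite big_mkcond.
    by apply: measurable_prod => k _; case: (k != k0) => //; exact: mF.
  - by move=> w; rewrite /h; apply: prodr_ge0 => k _; exact: F0.
  (* With the indicator of [B] at [k0], the identity to prove is the induction hypothesis for the
     family [A] modified at [k0]. *)
  - move=> B mB; pose A' k := if k == k0 then B else A k.
    have mA' k : measurable (A' k) by rewrite /A'; case: ifP.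
    have JE : J s A' k0 = fine (p k0 B) by rewrite /J (negbTE k0s) /A' eqxx.
    have FE w : F s A' k0 w = \1_B (Z k0 w) by rewrite /F (negbTE k0s) /A' eqxx.
    have := IH A' mA'; rewrite (bigD1 k0)//= JE => IH'.
    rewrite -(@fineK _ (p k0 B)) ?fin_num_measure// -EFinM mulrC.
    rewrite [X in _ = (_ * X)%:E](eq_bigr (J s A')); last first.
      by move=> k /negbTE kk0; rewrite /J /A' kk0.
    rewrite -IH'; apply: eq_integral => w _; congr EFin.
    rewrite [RHS](bigD1 k0)//= FE; congr (_ * _)%R.
    by apply: eq_bigr => k /negbTE kk0; rewrite /F /A' kk0.
have := main (enum K) (fun=> setT) (fun=> measurableT).
rewrite /J /F; under eq_integral do under eq_bigr do rewrite mem_enum.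
by move=> ->; congr EFin; apply: eq_bigr => k _; rewrite mem_enum.
Qed.
End independence.

(** * Tail bound for the divergence of an average of independent variables in [0, 1] *)

Lemma prodr_eq1 (R : realType) (K : finType) (f : K -> R) :
  \prod_k f k = 1 -> (forall k, 0 <= f k <= 1) -> forall k, f k = 1.
Proof.
move=> fp f01 k; apply/eqP; rewrite eq_le; case/andP: (f01 k) => f0 -> /=.
by rewrite -fp (bigD1 k)//= ler_piMr// prodr_ile1.
Qed.

Section kl_tail.
Local Open Scope ereal_scope.
Context d (Om : measurableType d) {R : realType} (P : probability Om R).

Lemma measurable_kl (u : Om -> R) (r : R) : measurable_fun setT u ->
  measurable_fun setT (fun w => kl (u w) r).
Proof.
move=> mu; have mterm (v : Om -> R) (y : R) : measurable_fun setT v ->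
    measurable_fun setT (fun w => klterm (v w) y).
  move=> mv; rewrite /klterm; apply: measurable_fun_ifT.
  - exact: measurable_fun_eqr.
  - exact: measurable_cst.
  case: (y == 0%R); first exact: measurable_cst.
  apply/measurable_EFinP/measurable_funM => //.
  by apply: measurableT_comp => //; exact: measurable_funM.
apply: emeasurable_funD; apply: mterm => //.
exact: measurable_funB.
Qed.

Lemma measurable_kl_gt (u : Om -> R) (r : R) (e : \bar R) : measurable_fun setT u ->
  measurable [set w | e < kl (u w) r].
Proof.
move=> mu; rewrite -[X in measurable X]setTI.
by apply: emeasurable_fun_o_infty => //; exact: measurable_kl.
Qed.

Lemma measurable_neq_cst (f : Om -> R) (c : R) : measurable_fun setT f ->
  measurable [set w | f w != c].
Proof.
move=> mf; have /(_ measurableT [set false]) := measurable_fun_eqr mf (measurable_cst c).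
rewrite setTI (_ : _ @^-1` _ = [set w | f w != c]); first exact.
by apply/seteqP; split => w /= => [->|/negbTE].
Qed.

(** The nonnegative function 1 - f has integral 0, hence vanishes almost surely. *)
Lemma le1_integral_eq1 (f : Om -> R) : measurable_fun setT f ->
  (forall w, (0 <= f w <= 1)%R) -> \int[P]_w (f w)%:E = 1 ->
  P [set w | f w != 1%R] = 0.
Proof.
move=> mf f01 f1.
have mf1 : measurable_fun setT (fun w => 1 - f w)%R by exact: measurable_funB.
have g0 w : 0 <= (1 - f w)%:E by rewrite lee_fin subr_ge0; case/andP: (f01 w).
have int0 : \int[P]_w (1 - f w)%:E = 0.
  have : \int[P]_w ((f w)%:E + (1 - f w)%:E) = 1.
    under eq_integral do rewrite -EFinD addrC subrK.
    by rewrite integral_cst// mul1e; exact: probability_setT.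
  rewrite ge0_integralD//; last 3 first.
  - by move=> w _; rewrite lee_fin; case/andP: (f01 w).
  - exact/measurable_EFinP.
  - exact/measurable_EFinP.
  rewrite f1; case: (\int[P]_w (1 - f w)%:E) => [y| |]//.
  by rewrite -EFinD => -[] /eqP; rewrite addrC -subr_eq0 addrK => /eqP ->.
have : \int[P]_w `|(1 - f w)%:E| = 0.
  by rewrite -[RHS]int0; apply: eq_integral => w _; rewrite gee0_abs.
move=> /ae_eq_integral_abs -/(_ measurableT).
move=> /(_ ltac:(exact/measurable_EFinP)) ae1.
apply/negligibleP; first exact: measurable_neq_cst.
apply: negligibleS ae1 => w /= /eqP fw h; apply: fw.
by have [/eqP] := h I; rewrite subr_eq0 => /eqP.
Qed.

Variables (K : finType) (x : K -> Om -> R) (q : K -> R) (t : Om -> R) (r : R).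
Hypothesis K0 : (0 < #|K|)%N.
Hypothesis mx : forall k, measurable_fun setT (x k).
Hypothesis x01 : forall k w, (0 <= x k w <= 1)%R.
Hypothesis q01 : forall k, (0 <= q k <= 1)%R.
Hypothesis mt : measurable_fun setT t.
Hypothesis tx : forall w, (t w * #|K|%:R = \sum_k x k w)%R.
Hypothesis rq : (r * #|K|%:R = \sum_k q k)%R.
(** The form in which independence and the means [q k] enter: products affine in each variable have
    the same expectation as for independent Bernoulli variables. *)
Hypothesis moments : forall B : {set K},
  \int[P]_w (bernoulli_pattern R K (x ^~ w) B)%:E = (bernoulli_pattern R K q B)%:E.

Lemma measurable_bernoulli_pattern B :
  measurable_fun setT (fun w => bernoulli_pattern R K (x ^~ w) B).
Proof.
apply: measurable_prod => k _; case: (k \in B) => //.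
exact: measurable_funB.
Qed.

(** The integrand is a nonnegative combination of patterns, so [moments] puts [q] in place of the
    variables and [sum_pattern_kt_ratio_le1] applies. *)
Lemma integral_sum_pattern_le : (0 < r < 1)%R ->
  \int[P]_w (\sum_(B : {set K}) bernoulli_pattern R K (x ^~ w) B *
                               kt_ratio #|K| r #|B|)%:E <= 1.
Proof.
move=> r01; apply: (@le_trans _ _
  (\sum_(B : {set K}) bernoulli_pattern R K q B * kt_ratio #|K| r #|B|)%:E); last first.
  by rewrite lee_fin; apply: sum_pattern_kt_ratio_le1.
under eq_integral do rewrite -sumEFin.
have p0 B w : (0 <= bernoulli_pattern R K (x ^~ w) B * kt_ratio #|K| r #|B|)%R.
  by rewrite mulr_ge0 ?bernoulli_pattern_ge0 ?kt_ratio_ge0.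
rewrite ge0_integral_sum//; last 2 first.
- move=> B; apply/measurable_EFinP/measurable_funM => //.
  exact: measurable_bernoulli_pattern.
- by move=> B w _; rewrite lee_fin.
rewrite -sumEFin; apply: lee_sum => B _.
under eq_integral do rewrite EFinM muleC.
rewrite ge0_integralZl//.
- by rewrite moments -EFinM mulrC.
- exact/measurable_EFinP/measurable_bernoulli_pattern.
- by move=> w _; rewrite lee_fin bernoulli_pattern_ge0.
- by rewrite lee_fin kt_ratio_ge0.
Qed.

(* When the mean is degenerate, so are the variables, almost surely. *)
Lemma kl_degenerate_null (e : \bar R) : 0 <= e -> (r == 0%R) || (r == 1%R) ->
  P [set w | e < kl (t w) r] = 0.
Proof.
(* [B] is the almost sure pattern: empty for r = 0, full for r = 1. Where its value is 1, all
   variables equal r, hence t = r and the divergence is 0. *)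
move=> e0 r01; have [B [qB tB]] : exists B : {set K}, bernoulli_pattern R K q B = 1%R /\
    forall w, bernoulli_pattern R K (x ^~ w) B = 1%R -> t w = r.
  have N0 : (#|K|%:R != 0 :> R)%R by rewrite pnatr_eq0 -lt0n.
  case/orP: r01 => /eqP r01.
    exists finset.set0; split.
      by apply: big1 => k _; rewrite finset.in_set0 (mean_eq0 K q r q01 rq)// subr0.
    rewrite /bernoulli_pattern => w.
    under eq_bigr do rewrite finset.in_set0.
    move=> /prodr_eq1 h; apply: (mulIf N0); rewrite tx r01 mul0r; apply: big1 => k _.
    have {}h : (1 - x k w = 1)%R.
      by apply: h => j; rewrite subr_ge0 lerBlDr lerDl andbC.
    by rewrite -[x k w](subKr 1%R) h subrr.
  exists [set: K]%SET; split.
    by apply: big1 => k _; rewrite finset.in_setT (mean_eq1 K q r q01 rq).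
  rewrite /bernoulli_pattern => w.
  under eq_bigr do rewrite finset.in_setT.
  move=> /prodr_eq1 h; apply: (mulIf N0); rewrite tx r01 mul1r -sumr_const.
  by apply: eq_bigr => k _; apply: h.
apply/eqP; rewrite eq_le measure_ge0 andbT.
rewrite -(le1_integral_eq1 (fun w => bernoulli_pattern R K (x ^~ w) B)).
- apply: le_measure; rewrite ?inE.
  + exact: measurable_kl_gt.
  + exact/measurable_neq_cst/measurable_bernoulli_pattern.
  move=> w /=; apply: contraTneq => /tB ->.
  rewrite -leNgt /kl /klterm; case/orP: r01 => /eqP ->.
    by rewrite eqxx subr0 oner_eq0 divr1 ln1 mulr0 adde0.
  by rewrite subrr eqxx oner_eq0 divr1 ln1 mulr0 adde0.
- exact: measurable_bernoulli_pattern.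
- by move=> w; rewrite bernoulli_pattern_ge0// bernoulli_pattern_le1.
- by rewrite moments qB.
Qed.

Lemma kl_tail (e : R) : (0 <= e)%R ->
  P [set w | e%:E < kl (t w) r] <=
    (2 * Num.sqrt #|K|%:R * expR (- (#|K|%:R * e)))%:E.
Proof.
move=> e0; have /andP[r0' r1'] := mean_01 K q r K0 q01 rq.
have c0 : (0 <= 2 * Num.sqrt #|K|%:R :> R)%R by rewrite mulr_ge0 ?sqrtr_ge0.
(* For r in {0, 1} the divergence can be infinite and [kt_ratio] can divide by 0, so these means are
   treated apart. *)
have [r01|/norP[r0 r1]] := boolP ((r == 0%R) || (r == 1%R)).
  rewrite (_ : P _ = 0); first by rewrite lee_fin mulr_ge0 ?expR_ge0.
  exact: kl_degenerate_null.
have r01 : (0 < r < 1)%R by apply/andP; split; rewrite lt_def ?r0 ?r1' ?andbT// eq_sym.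
set S := [set w | _].
have mS : measurable S by exact: measurable_kl_gt.
pose V w : R := (\sum_(B : {set K}) bernoulli_pattern R K (x ^~ w) B * kt_ratio #|K| r #|B|)%R.
have mV : measurable_fun setT V.
  apply: measurable_sum => B; apply: measurable_funM => //.
  exact: measurable_bernoulli_pattern.
have V0 w : (0 <= V w)%R.
  by apply: sumr_ge0 => B _; rewrite mulr_ge0 ?bernoulli_pattern_ge0 ?kt_ratio_ge0.
(* Markov's inequality, from a pointwise bound: on [S], exp (N e) <= exp (N kl) <= 2 sqrt N [V w];
   off [S] the left integrand is 0. *)
have : \int[P]_w ((expR (#|K|%:R * e))%:E * (\1_S w)%:E) <=
       \int[P]_w ((2 * Num.sqrt #|K|%:R)%:E * (V w)%:E).
  apply: ge0_le_integral => //.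
  - by apply: measurable_funeM; exact/measurable_EFinP.
  - by apply: measurable_funeM; exact/measurable_EFinP.
  move=> w _; rewrite -!EFinM lee_fin indicE; have [Sw|_] := boolP (w \in S); last first.
    by rewrite mulr0 mulr_ge0.
  rewrite mulr1; have [D klE dV] := expR_kl_le K (x ^~ w) (t w) K0 (x01 ^~ w) (tx w) r r01.
  move: Sw; rewrite inE /S/= klE lte_fin => ed.
  by apply: le_trans dV; rewrite ler_expR ler_pM2l ?ltr0n// ltW.
rewrite !ge0_integralZl//; last 3 first.
- exact/measurable_EFinP.
- by move=> w _; rewrite lee_fin.
- exact/measurable_EFinP.
rewrite integral_indic// setIT => le.
have {}le : (expR (#|K|%:R * e))%:E * P S <= (2 * Num.sqrt #|K|%:R)%:E.
  apply: le_trans le _; rewrite -[leRHS]mule1; apply: lee_wpmul2l => //.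
  exact: integral_sum_pattern_le.
by rewrite expRN EFinM muleC lee_pdivlMl ?expR_gt0.
Qed.
End kl_tail.

(** * Prefix-free codes: concatenation, Kraft's inequality and the union bound *)

Lemma prefix_comparable (u v s : seq bool) : prefix u s -> prefix v s ->
  prefix u v || prefix v u.
Proof.
move=> /prefixP[u' ->] /prefixP[v']; elim: u v => [|a u IH] [|b v]//=.
by move=> [<-] /IH; rewrite eqxx.
Qed.

(** If one concatenation is a prefix of another, their first codewords are prefixes of a common
    word, hence comparable, hence equal. Cancelling them leaves two codewords of the same second
    code. *)
Lemma prefix_free_cat (I J : Type) (D : set I) (D' : I -> set J)
    (c : I -> seq bool) (c' : I -> J -> seq bool) :
  prefix_free_on D c -> (forall i, D i -> prefix_free_on (D' i) (c' i)) ->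
  prefix_free_on [set ij : I * J | D ij.1 /\ D' ij.1 ij.2]
    (fun ij => c ij.1 ++ c' ij.1 ij.2).
Proof.
move=> pc pc' [i j] [i' j'] [/= Di Dj] [/= Di' Dj'] ne; apply/negP => pre.
have ii' : i = i'.
  apply: contrapT => ni; have := prefix_comparable (c i) (c i') _
    (prefix_trans (prefix_prefix _ _) pre) (prefix_prefix _ _).
  by rewrite (negbTE (pc _ _ Di Di' ni)) (negbTE (pc _ _ Di' Di (nesym ni))).
subst i'; move: pre; rewrite prefix_catr// => pre.
have jj' : j <> j' by move=> jj'; apply: ne; rewrite jj'.
by move: pre; rewrite eqxx (negbTE (pc' i Di j j' Dj Dj' jj')).
Qed.

(** Induction on the maximal length. The empty word, if present, is the only word. Otherwise the
    words with first letter [b], once deprived of it, form a shorter prefix-free list, and so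
    contribute at most 1/2. *)
Lemma kraft_inequality (R : realFieldType) (ws : seq (seq bool)) : uniq ws ->
  {in ws &, forall u v, u != v -> ~~ prefix u v} ->
  \sum_(w <- ws) (2^-1 : R) ^+ size w <= 1.
Proof.
have [n] : exists n, {in ws, forall w, (size w <= n)%N}.
  by exists (\max_(w <- ws) size w)%N => w ws_w; exact: leq_bigmax_seq.
elim: n ws => [|n IH] ws le_n uws pws;
    (have [nil_ws|nil_ws] := boolP ([::] \in ws);
      [have all_nil w : w \in ws -> w = [::] by
         move=> ws_w; apply/eqP; apply: contraT; rewrite eq_sym => /pws;
         rewrite prefix0s => /(_ nil_ws ws_w) |]).
- case: ws {le_n pws} uws nil_ws all_nil => [//|w [|w' ws]] uws _ all_nil.
    by rewrite big_seq1 (all_nil w) ?mem_head// expr0.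
  move: uws; rewrite (all_nil w) ?mem_head// (all_nil w') ?inE ?eqxx ?orbT//.
- rewrite big_seq big1// => w ws_w; have := le_n w ws_w.
  by rewrite leqn0 => /nilP w0; rewrite -w0 ws_w in nil_ws.
- case: ws {le_n pws} uws nil_ws all_nil => [//|w [|w' ws]] uws _ all_nil.
    by rewrite big_seq1 (all_nil w) ?mem_head// expr0.
  move: uws; rewrite (all_nil w) ?mem_head// (all_nil w') ?inE ?eqxx ?orbT//.
have half b : \sum_(w <- ws | ohead w == Some b) (2^-1 : R) ^+ size w <= 2^-1.
  pose tails := [seq behead w | w <- ws & ohead w == Some b].
  have in_tails v : v \in tails -> b :: v \in ws.
    by case/mapP => -[|b' w]; rewrite mem_filter//= => /andP[/eqP[->] ?] ->.
  rewrite (_ : \sum_(w <- ws | _) _ = 2^-1 * \sum_(v <- tails) 2^-1 ^+ size v).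
    rewrite ler_piMr//; apply: IH.
    - by move=> v /in_tails/le_n.
    - rewrite map_inj_in_uniq ?filter_uniq// => -[|b1 u] [|b2 v];
        rewrite !mem_filter//=.
      by move=> /andP[/eqP[->] _] /andP[/eqP[->] _] ->.
    - move=> u v /in_tails bu /in_tails bv uv; have := pws _ _ bu bv.
      by rewrite eqseq_cons prefix_cons eqxx; apply.
  rewrite big_map big_filter mulr_sumr; apply: eq_bigr => -[|b' w]//= _.
  by rewrite exprS.
rewrite (bigID (fun w => ohead w == Some true))/= [leRHS](_ : 1 = 2^-1 + 2^-1 :> R); last by lra.
apply: lerD; first exact: half.
rewrite big_seq_cond (eq_bigl (fun w => (w \in ws) && (ohead w == Some false))).
  by rewrite -big_seq_cond; exact: half.
by move=> -[|[] w]/=; rewrite ?(negbTE nil_ws) ?andbF ?andbT.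
Qed.

Lemma sum_pmap (R : nmodType) (I J : Type) (f : I -> option J) (g : J -> R) (s : seq I) :
  \sum_(j <- pmap f s) g j = \sum_(i <- s) (if f i is Some j then g j else 0).
Proof.
elim: s => [|i s IH]; first by rewrite !big_nil.
by rewrite big_cons /=; case: (f i) => [j|] /=; rewrite ?big_cons IH ?add0r.
Qed.

Section prefix_free_union_bound.
Context d (Om : measurableType d) {R : realType} (P : {measure set Om -> \bar R}).
Variables (I : Type) (D : set I) (c : I -> seq bool) (B : I -> set Om).
Hypothesis pc : prefix_free_on D c.
Hypothesis mB : forall i, D i -> measurable (B i).

(** The index type [I] comes without an enumeration; the union is made countable by numbering the
    binary words. The set indexing the union has at most one element, as [c] is injective on [D]. *)
Let event (n : nat) : set Om :=
  \bigcup_(i in [set i | D i /\ pickle_inv n = Some (c i)]) B i.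

Let eventE n i : D i -> pickle_inv n = Some (c i) -> event n = B i.
Proof.
move=> Di ni; rewrite /event (_ : mkset _ = [set i]) ?bigcup_set1//.
apply/seteqP; split => [j /= [Dj]|j /= ->//]; rewrite ni => -[cij].
by apply: contrapT => /(pc _ _ Dj Di); rewrite cij prefix_refl.
Qed.

Let event_bigcup : \bigcup_(i in D) B i = \bigcup_n event n.
Proof.
apply/seteqP; split => [w [i Di Biw]|w [n _ [i [Di _] Biw]]]; last by exists i.
by exists (pickle (c i)) => //; exists i => //; split => //; exact: pickleK_inv.
Qed.

Let measurable_event n : measurable (event n).
Proof.
have [[i [Di ni]]|none] := pselect (exists i, D i /\ pickle_inv n = Some (c i)).
  by rewrite (eventE n i)//; exact: mB.
rewrite /event (_ : mkset _ = set0) ?bigcup_set0//.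
by apply/seteqP; split => // i Hi; apply: none; exists i.
Qed.

Lemma measurable_prefix_free_bigcup : measurable (\bigcup_(i in D) B i).
Proof. by rewrite event_bigcup; exact: bigcup_measurable. Qed.

(** Countable subadditivity, where each partial sum is bounded by Kraft's inequality for the
    finitely many codewords it involves. *)
Lemma prefix_free_union_bound (delta : R) : 0 <= delta ->
  (forall i, D i -> P (B i) <= (delta * 2^-1 ^+ size (c i))%:E)%E ->
  (P (\bigcup_(i in D) B i) <= delta%:E)%E.
Proof.
move=> d0 PB.
apply: (@le_trans _ _ (\sum_(n <oo) P (event n))%E).
  apply: measure_sigma_subadditive => //; first exact: measurable_prefix_free_bigcup.
  by rewrite event_bigcup.
apply: lime_le; first by apply: is_cvg_nneseries => n _ _; exact: measure_ge0.
apply: nearW => N.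
(* Only the words that are codes of elements of [D] are kept: the list must be prefix-free, and
   [event n] is empty for the other words. *)
pose used (w : seq bool) := `[< exists2 i, D i & c i = w >].
pose code n := if pickle_inv n is Some w then if used w then Some w else None else None.
apply: (@le_trans _ _ (\sum_(0 <= n < N)
    (if code n is Some w then delta * 2^-1 ^+ size w else 0)%:E)%E).
  apply: lee_sum => n _; rewrite /code.
  case E : (pickle_inv n) => [w|]; last first.
    rewrite /event (_ : mkset _ = set0) ?bigcup_set0 ?measure0//.
    by apply/seteqP; split => // i [_]; rewrite E.
  rewrite /used; case: asboolP => [[i Di ciw]|nw].
    by rewrite (eventE n i) ?E ?ciw// -ciw; exact: PB.
  rewrite /event (_ : mkset _ = set0) ?bigcup_set0 ?measure0//.
  apply/seteqP; split => // i [Di]; rewrite E => -[wci].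
  by apply: nw; exists i.
rewrite sumEFin lee_fin -sum_pmap -mulr_sumr -[leRHS]mulr1 ler_wpM2l//.
apply: kraft_inequality.
  apply: (@pmap_uniq _ _ code pickle); last exact: iota_uniq.
  move=> n; rewrite /code.
  have := @pickle_invK (seq bool) n; case: (pickle_inv n) => [w|]//= wn.
  by case: (used w).
have used_code u : u \in pmap code (index_iota 0 N) -> exists2 i, D i & c i = u.
  rewrite mem_pmap => /mapP[n _]; rewrite /code; case: (pickle_inv n) => [w|]//.
  by rewrite /used; case: asboolP => // wu [->].
move=> u v /used_code[i Di <-] /used_code[j Dj <-] ij.
by apply: pc => // eij; rewrite eij eqxx in ij.
Qed.

End prefix_free_union_bound.

(** * Expected losses and the tail bound for one tuple of models *)

Section unit_interval_expectation.
Local Open Scope ereal_scope.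
Context d (T : measurableType d) {R : realType} (mu : probability T R).
Variables (f : T -> R).
Hypotheses (mf : measurable_fun setT f) (f01 : forall z, (0 <= f z <= 1)%R).

(** Two nonnegative integrals of sum 1 are finite, so [fine] loses nothing. *)
Let integral_split : \int[mu]_z (f z)%:E + \int[mu]_z (1 - f z)%:E = 1.
Proof.
rewrite -ge0_integralD//.
- under eq_integral do rewrite -EFinD addrC subrK.
  by rewrite integral_cst// mul1e; exact: probability_setT.
- by move=> z _; rewrite lee_fin; case/andP: (f01 z).
- exact/measurable_EFinP.
- by move=> z _; rewrite lee_fin subr_ge0; case/andP: (f01 z).
- exact/measurable_EFinP/measurable_funB.
Qed.

Let integral_f0 : 0 <= \int[mu]_z (f z)%:E.
Proof. by apply: integral_ge0 => z _; rewrite lee_fin; case/andP: (f01 z). Qed.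

Let integral_onem0 : 0 <= \int[mu]_z (1 - f z)%:E.
Proof. by apply: integral_ge0 => z _; rewrite lee_fin subr_ge0; case/andP: (f01 z). Qed.

Lemma fine_integral_onem :
  fine (\int[mu]_z (1 - f z)%:E) = (1 - fine (\int[mu]_z (f z)%:E))%R.
Proof.
move: integral_split integral_f0 integral_onem0.
case: (\int[mu]_z (f z)%:E) => [a| |]//; case: (\int[mu]_z _) => [b| |]//=.
by rewrite -EFinD => -[<-] _ _; rewrite addrC addKr.
Qed.

Lemma fine_integral_01 : (0 <= fine (\int[mu]_z (f z)%:E) <= 1)%R.
Proof.
move: integral_split integral_f0 integral_onem0.
case: (\int[mu]_z (f z)%:E) => [a| |]//; case: (\int[mu]_z _) => [b| |]//=.
by rewrite -EFinD => -[<-]; rewrite !lee_fin => -> b0; rewrite lerDl.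
Qed.

End unit_interval_expectation.

Section multitask_tail.
Context {R : realType} {dO dX dY : measure_display}.
Context {Om : measurableType dO} {X : measurableType dX} {Y : measurableType dY}.
Variables (n m : nat) (hn : (0 < n)%N) (hm : (0 < m)%N).
Variables (p : 'I_n -> probability (X * Y)%type R) (loss : 'I_n -> Y -> Y -> R).
Hypothesis loss01 : forall i y y', 0 <= loss i y y' <= 1.
Variables (P : probability Om R) (Z : 'I_n -> 'I_m -> Om -> (X * Y)%type).
Hypothesis iidZ : iid_samples P p Z.
Variable f : 'I_n -> X -> Y.
Hypothesis mloss : forall i, measurable_fun setT (fun z : X * Y => loss i z.2 (f i z.1)).

Let emp w := emp_risk loss (fun i j => Z i j w) f.
Let risk := mt_risk p loss f.

Let mZ i j : measurable_fun setT (Z i j). Proof. by case: iidZ. Qed.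

Lemma measurable_emp_risk : measurable_fun setT emp.
Proof.
apply: measurable_funM => //; apply: measurable_sum => i; apply: measurable_sum => j.
exact: (measurableT_comp (mloss i) (mZ i j)).
Qed.

Lemma measurable_kl_emp_risk_gt (e : R) : measurable [set w | (e%:E < kl (emp w) risk)%E].
Proof. exact/measurable_kl_gt/measurable_emp_risk. Qed.

(** The mn losses form a single independent family indexed by the pairs (i, j). Their laws differ
    between tasks, but [kl_tail] asks only that their means average to the risk. *)
Lemma kl_emp_risk_tail (e : R) : 0 <= e ->
  (P [set w | (e%:E < kl (emp w) risk)%E] <=
    (2 * Num.sqrt (m * n)%:R * expR (- ((m * n)%:R * e)))%:E)%E.
Proof.
move=> e0; pose K : finType := ('I_n * 'I_m)%type.
have cardK : #|K| = (m * n)%N by rewrite card_prod !card_ord mulnC.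
pose phi (k : K) (z : X * Y) : R := loss k.1 z.2 (f k.1 z.1).
have mphi k : measurable_fun setT (phi k) by exact: mloss.
have phi01 k z : 0 <= phi k z <= 1 by exact: loss01.
pose q (k : K) : R := fine (\int[p k.1]_z (phi k z)%:E)%E.
have N0 : (m * n)%:R != 0 :> R by rewrite pnatr_eq0 -lt0n muln_gt0 hm hn.
rewrite -cardK; apply: (kl_tail _ _ P K (fun k w => phi k (Z k.1 k.2 w)) q) => //.
- by rewrite cardK muln_gt0 hn hm.
- by move=> k; exact: (measurableT_comp (mphi k) (mZ k.1 k.2)).
- by move=> k; apply: fine_integral_01.
- exact: measurable_emp_risk.
- by move=> w; rewrite cardK /emp /emp_risk mulrC mulVKf// pair_bigA.
- rewrite cardK /risk /mt_risk natrM mulrC -mulrA mulVKf ?pnatr_eq0 -?lt0n//.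
  rewrite -(pair_bigA _ (fun i j => q (i, j)))/= mulr_sumr; apply: eq_bigr => i _.
  by rewrite /q /phi/= sumr_const card_ord mulr_natl.
(* A pattern is a product of functions of one sample point each, the loss on [B] and its complement
   to 1 off [B], so independence yields the moments. *)
move=> B; pose g (k : K) z : R := if k \in B then phi k z else 1 - phi k z.
rewrite [LHS](_ : _ = \int[P]_w (\prod_k g k (Z k.1 k.2 w))%:E)%E; last first.
  apply: eq_integral => w _; congr EFin.
rewrite (integral_prod_indep _ _ _ _ _ P (fun k : K => p k.1) (fun k : K => Z k.1 k.2)).
- congr EFin; apply: eq_bigr => k _; rewrite /g; case: (k \in B) => //.
  by rewrite fine_integral_onem.
- by move=> k; exact: mZ.
- move=> A mA; case: iidZ => _ /(_ (fun i j => A (i, j)) (fun i j => mA (i, j))).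
  rewrite (pair_bigA _ (fun i j => p i (A (i, j))))/= => iid.
  rewrite (_ : [set w | _] = [set w | forall i j, A (i, j) (Z i j w)]); last first.
    by apply/seteqP; split => w h; [move=> i j; exact: (h (i, j))|case=> i j; exact: h].
  by rewrite iid; apply: eq_bigr => -[].
- by move=> k; rewrite /g; case: (k \in B) => //; exact: measurable_funB.
- move=> k z; rewrite /g; case: (k \in B) => //; have /andP[h0 h1] := phi01 k z.
  by rewrite subr_ge0 h1 lerBlDr lerDl.
Qed.

End multitask_tail.

Theorem theorem3 (R : realType) (dO dX dY : measure_display)
  (Om : measurableType dO) (X : measurableType dX) (Y : measurableType dY)
  (F : set (X -> Y)) (n m : nat) (hn : (0 < n)%N) (hm : (0 < m)%N)
  (p : 'I_n -> probability (X * Y)%type R)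
  (loss : 'I_n -> Y -> Y -> R)
  (hloss : forall i y y', 0 <= loss i y y' <= 1)
  (hmeas : forall i f, F f -> measurable_fun setT (fun z : X * Y => loss i z.2 (f z.1)))
  (P : probability Om R) (Z : 'I_n -> 'I_m -> Om -> (X * Y)%type)
  (hZ : iid_samples P p Z)
  (Eg : Type) (l : Eg -> nat) (hl : is_prefix_free_length setT l)
  (lE : Eg -> seq (X -> Y) -> nat)
  (hlE : forall e, is_prefix_free_length (tuples_of F) (lE e))
  (delta : R) (hdelta : 0 < delta) :
  ((1 - delta)%:E <=
   P [set w | forall (e : Eg) (f : 'I_n -> X -> Y), (forall i, F (f i)) ->
        (kl (emp_risk loss (fun i j => Z i j w) f) (mt_risk p loss f) <=
         ((((l e + lE e (map f (enum 'I_n)))%:R * ln 2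
            + ln (2 * Num.sqrt (m * n)%:R / delta)) / (m * n)%:R)%:E))%E])%E.
Proof.
(* For [delta >= 1] the left side is at most 0. *)
have [delta_ge1|delta_lt1] := leP 1 delta.
  by apply: le_trans (measure_ge0 P _); rewrite lee_fin subr_le0.
have [C [pC lC]] := hl.
have [C' pC'] := choice hlE.
pose D (ef : Eg * ('I_n -> X -> Y)) := setT ef.1 /\ [set f | forall i, F (f i)] ef.2.
pose c (ef : Eg * ('I_n -> X -> Y)) := C ef.1 ++ C' ef.1 (map ef.2 (enum 'I_n)).
have tuples_ofP (f : 'I_n -> X -> Y) : (forall i, F (f i)) ->
    tuples_of F (map f (enum 'I_n)).
  move=> Ff; split; first by rewrite size_map size_enum_ord.
  by move=> a; elim: (enum _) => [|i s IH]//= [<-|/IH].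
have pc : prefix_free_on D c.
  apply: (prefix_free_cat _ _ setT
    (fun=> [set f : 'I_n -> X -> Y | forall i, F (f i)]) C
    (fun e f => C' e (map f (enum 'I_n)))) => // e _.
  move=> f f' Ff Ff' ff'; have [pe _] := pC' e.
  apply: pe; [exact: tuples_ofP|exact: tuples_ofP|move=> /eq_in_map h].
  by apply: ff'; apply/funext => i; apply: h; rewrite mem_enum.
pose bound (ef : Eg * ('I_n -> X -> Y)) : R :=
  ((size (c ef))%:R * ln 2 + ln (2 * Num.sqrt (m * n)%:R / delta)) / (m * n)%:R.
have boundE e f : (forall i, F (f i)) -> ((l e + lE e (map f (enum 'I_n)))%:R * ln 2
    + ln (2 * Num.sqrt (m * n)%:R / delta)) / (m * n)%:R = bound (e, f).
  by move=> Ff; rewrite /bound /c size_cat/= lC// (pC' e).2//; exact: tuples_ofP.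
have N0 : 0 < (m * n)%:R :> R by rewrite ltr0n muln_gt0 hm.
have sqrt_ge1 : 1 <= Num.sqrt (m * n)%:R :> R.
  by rewrite -[leLHS]sqrtr1 ler_sqrt// ler1n muln_gt0 hm.
have sqrt_gt0 : 0 < Num.sqrt (m * n)%:R :> R by exact: lt_le_trans sqrt_ge1.
have ratio_gt0 : 0 < 2 * Num.sqrt (m * n)%:R / delta by rewrite divr_gt0// mulr_gt0.
(* The tail bound requires a nonnegative threshold; here 2 sqrt(mn) / delta >= 1 because
   [delta < 1]. *)
have bound_ge0 ef : 0 <= bound ef.
  rewrite divr_ge0//; apply: addr_ge0; first by rewrite mulr_ge0// ln_ge0//; lra.
  by rewrite ln_ge0// ler_pdivlMr// mul1r; lra.
pose B (ef : Eg * ('I_n -> X -> Y)) := [set w | ((bound ef)%:E <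
  kl (emp_risk loss (fun i j => Z i j w) ef.2) (mt_risk p loss ef.2))%E].
have mloss (f : 'I_n -> X -> Y) : (forall i, F (f i)) ->
    forall i, measurable_fun setT (fun z : X * Y => loss i z.2 (f i z.1)).
  by move=> Ff i; exact: hmeas.
have mB ef : D ef -> measurable (B ef).
  by move=> [_ Ff]; exact: (measurable_kl_emp_risk_gt n m p loss P Z hZ ef.2 (mloss _ Ff)).
have PB ef : D ef -> (P (B ef) <= (delta * 2^-1 ^+ size (c ef))%:E)%E.
  move=> [_ Ff]; have := kl_emp_risk_tail n m hn hm p loss hloss P Z hZ
    ef.2 (mloss _ Ff) _ (bound_ge0 ef).
  (* The threshold is chosen for this: exp (- mn [bound]) = 2^-L delta / (2 sqrt(mn)) with L the
     code length, which cancels the factor 2 sqrt(mn) of the tail bound. *)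
  rewrite (_ : 2 * _ * expR _ = delta * 2^-1 ^+ size (c ef))//.
  rewrite /bound [(m * n)%:R * _]mulrC divfK ?gt_eqF// opprD expRD -mulrN expRM_natl.
  rewrite !expRN !lnK ?posrE//.
  by field; rewrite !gt_eqF.
have PU := prefix_free_union_bound _ _ P _ _ _ _ pc mB _ (ltW hdelta) PB.
have mU := measurable_prefix_free_bigcup _ _ _ _ _ _ pc mB.
set G := [set w | _].
(* The good event is the complement of the union of the bad events, which gives its measurability as
   well. *)
have -> : G = ~` \bigcup_(ef in D) B ef.
  apply/seteqP; split => [w Gw [[e f] [_ Ff]]|w Uw e f Ff].
    by rewrite /B/= ltNge -boundE// Gw.
  rewrite boundE// leNgt; apply/negP => lt; apply: Uw.
  by exists (e, f).
rewrite probability_setC// EFinB; exact: leeB.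
Qed.
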